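(* Let $\alpha$ be a special Pisot unit, $\beta=\alpha/(\alpha-1)$, such that $\alpha^p=\beta^2$ holds for an integer $p\ge 3$ (i.e. $p\in\{3,4,6,8,10\}$). Let $\zeta_p$ be the substitution over $\mathcal{A}=\{0,\dots,p-1\}$ given by $$0\mapsto 10,\quad k\mapsto k+1\ (1\le k\le p-2),\quad (p-1)\mapsto(p-1)0.$$ Then $\zeta_p$ is a primitive unimodular Pisot substitution with dominant root $\alpha$, and $\mathcal{R}_{\zeta_p}(k)\cong X_k$ for all $k\in\mathcal{A}$, where $$X_k=\begin{cases} f_L^k\circ f_R(\mathcal{F}_\alpha), & k\in\{0,\dots,p-2\};\\ f_L^{p-1}(\mathcal{F}_\alpha), & k=p-1.\end{cases}$$
   Context: Tent-tiles. A Pisot number is an algebraic integer that is a real number $>1$ whose other Galois conjugates have modulus $<1$. A special Pisot unit is a Pisot number $\alpha$ that is an algebraic unit and for which $\beta=\alpha/(\alpha-1)$ is also a Pisot number. Let $d+1$ be the degree of $\alpha$, with further real conjugates $\alpha^{(1)},\dots,\alpha^{(r)}$ and non-real conjugates $\alpha^{(r+1)},\overline{\alpha^{(r+1)}},\dots,\alpha^{(r+s)},\overline{\alpha^{(r+s)}}$. Put $\mathbb{K}_\alpha=\mathbb{R}^r\times\mathbb{C}^s$; for $z\in\mathbb{Q}(\alpha)$ let $z^{(k)}$ be its image under $\alpha\mapsto\alpha^{(k)}$, $\psi(z)=(z^{(1)},\dots,z^{(r+s)})^T$, and $\Psi[z](x_1,\dots,x_{r+s})=(z^{(1)}x_1,\dots,z^{(r+s)}x_{r+s})^T$.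 Put $f_L(x)=\Psi[\alpha](x)$, $f_R(x)=\Psi[\beta](\psi(1)-x)$. The tent-tile $\mathcal{F}_\alpha$ is the unique non-empty compact set with $\mathcal{F}_\alpha=f_L(\mathcal{F}_\alpha)\cup f_R(\mathcal{F}_\alpha)$. Powers $f_L^k$ denote iterates. Rauzy fractals. Let $\mathcal{A}=\{0,\dots,m\}$ and $\mathcal{A}^*$ the free monoid of finite words over $\mathcal{A}$ (empty word $\varepsilon$). For $W\in\mathcal{A}^*$ let $\ell(W)=(|W|_0,\dots,|W|_m)^T$ count letter occurrences. A substitution $\zeta$ is a non-erasing endomorphism of $\mathcal{A}^*$; its incidence matrix $M_\zeta$ has columns $\ell(\zeta(0)),\dots,\ell(\zeta(m))$. It is primitive if some power $\zeta^k$ ($k\ge1$) has all entries of $\ell(\zeta^k(a))$ positive for every $a\in\mathcal{A}$. For primitive $\zeta$, the dominant root $\lambda$ is the Perron–Frobenius eigenvalue of $M_\zeta$; $\zeta$ is unimodular if $\det M_\zeta=\pm1$ and Pisot if $\lambda$ is a Pisot number. Let $\nu$ be a left eigenvector of $M_\zeta$ for $\lambda$ with strictly positive entries in $\mathbb{Q}(\lambda)$. With the conjugates of $\lambda$ different from $\lambda$ being real $\lambda^{(1)},\dots,\lambda^{(r)}$ and non-real $\lambda^{(r+1)},\overline{\lambda^{(r+1)}},\dots,\lambda^{(r+s)},\overline{\lambda^{(r+s)}}$, put $\mathbb{K}_\zeta=\mathbb{R}^r\times\mathbb{C}^s$, $\pi(z)=(z^{(1)},\dots,z^{(r+s)})^T$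 for $z\in\mathbb{Q}(\lambda)$ (images under $\lambda\mapsto\lambda^{(k)}$), $h(x_1,\dots,x_{r+s})=(\lambda^{(1)}x_1,\dots,\lambda^{(r+s)}x_{r+s})^T$, and for $U\in\mathcal{A}^*$, $g_U(x)=\pi(\langle\nu,\ell(U)\rangle)+h(x)$. The sets $\mathcal{R}_\zeta(a)$, $a\in\mathcal{A}$, are the unique non-empty compact subsets of $\mathbb{K}_\zeta$ with $$\mathcal{R}_\zeta(a)=\bigcup_{(b,U,V):\ \zeta(b)=UaV} g_U(\mathcal{R}_\zeta(b))\qquad(a\in\mathcal{A},\ b\in\mathcal{A},\ U,V\in\mathcal{A}^* ).$$ They are determined up to a linear isomorphism (depending on the choice of $\nu$ and of the ordering of conjugates). Here ''$\mathcal{R}_\zeta(k)\cong X_k$ for all $k$'' means: there is a linear bijection $\Phi:\mathbb{K}_\alpha\to\mathbb{K}_\zeta$, the same for all $k\in\mathcal{A}$, with $\mathcal{R}_\zeta(k)=\Phi(X_k)$. *)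

(* Defs.v *)
From HB Require Import structures.
From mathcomp Require Import all_boot all_order all_algebra.
From mathcomp Require Import complex.
From mathcomp Require Import all_classical all_reals all_analysis.

Set Implicit Arguments.
Unset Strict Implicit.
Unset Printing Implicit Defensive.

Import Order.TTheory GRing.Theory Num.Theory.
Import numFieldNormedType.Exports.

Local Open Scope classical_set_scope.
Local Open Scope ring_scope.

(* The usual topology on the complex numbers [R[i]]. *)
HB.instance Definition _ (R : realType) := NormedModule.copy R[i] (R[i]^o).

(* [z] is a Galois conjugate of [x] ([x] itself included): both are roots of
   the same irreducible rational polynomial. *)
Definition galois_conj (R : realType) (x : R) (z : R[i]) : Prop :=
  exists p : {poly rat},
    [/\ irreducible_poly p, root (map_poly ratr p) x
      & root (map_poly ratr p) z].

Definition algebraic_integer (R : realType) (x : R) : Prop :=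
  integralOver (intr : int -> R) x.

Definition pisot_number (R : realType) (x : R) : Prop :=
  [/\ 1 < x, algebraic_integer x
    & forall z : R[i], galois_conj x z -> z != x%:C%C -> `|z| < 1].

Definition beta (R : realType) (alpha : R) : R := alpha / (alpha - 1).

Definition special_pisot_unit (R : realType) (alpha : R) : Prop :=
  [/\ pisot_number alpha, algebraic_integer alpha^-1
    & pisot_number (beta alpha)].

(* The space R^r x C^s, with the product topology. *)
Definition Kspace (R : realType) (r s : nat) : Type :=
  ('rV[R]_r * 'rV[R[i]]_s)%type.

Definition kadd (R : realType) (r s : nat) (x y : Kspace R r s) :
  Kspace R r s := (x.1 + y.1, x.2 + y.2).

Definition ksub (R : realType) (r s : nat) (x y : Kspace R r s) :
  Kspace R r s := (x.1 - y.1, x.2 - y.2).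

(* The componentwise product. *)
Definition kmul (R : realType) (r s : nat) (x y : Kspace R r s) :
  Kspace R r s := (map2_mx *%R x.1 y.1, map2_mx *%R x.2 y.2).

Definition kscale (R : realType) (r s : nat) (a : R) (x : Kspace R r s) :
  Kspace R r s := (a *: x.1, a%:C%C *: x.2).

(* R-linearity; the complex coordinates are regarded as real planes. *)
Definition klinear (R : realType) (r s r' s' : nat)
    (Phi : Kspace R r s -> Kspace R r' s') : Prop :=
  forall (a : R) (x y : Kspace R r s),
    Phi (kadd (kscale a x) y) = kadd (kscale a (Phi x)) (Phi y).

(* The r real and s complex coordinates of [c] list the Galois conjugates of
   [x] other than [x]: the real ones, and one from each pair of non-real
   complex conjugate ones (non-reality of the entries of [c.2] is forced by
   the absence of repetitions). *)
Definition conjugates_of (R : realType) (r s : nat) (x : R)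
    (c : Kspace R r s) : Prop :=
  let cs := [seq (c.1 0 i)%:C%C | i : 'I_r]
            ++ [seq c.2 0 j | j : 'I_s] ++ [seq conjc (c.2 0 j) | j : 'I_s] in
  uniq cs /\ forall z : R[i], z \in cs <-> galois_conj x z /\ z != x%:C%C.

(* The field Q(x). *)
Definition Qadj (R : realType) (x : R) : set R :=
  [set z | exists q : {poly rat}, z = (map_poly ratr q).[x]].

(* The image of z in Q(x) under the field embedding sending [x] to its
   conjugate [y]: if z = q(x), this is q(y), whatever the choice of q. *)
Definition conj_image (R : realType) (F : fieldType) (x : R) (y : F) (z : R) :
  F := (map_poly ratr
         (xget 0 [set q : {poly rat} | z = (map_poly ratr q).[x]])).[y].

(* z |-> (z^(1), ..., z^(r+s)), where [c] lists the conjugates of [x]. *)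
Definition embed (R : realType) (r s : nat) (x : R) (c : Kspace R r s) (z : R) :
  Kspace R r s :=
  (map_mx (fun y => conj_image x y z) c.1,
   map_mx (fun y => conj_image x y z) c.2).

Section TentTile.
Variables (R : realType) (r s : nat) (alpha : R) (c : Kspace R r s).

Definition fL (x : Kspace R r s) : Kspace R r s :=
  kmul (embed alpha c alpha) x.

Definition fR (x : Kspace R r s) : Kspace R r s :=
  kmul (embed alpha c (beta alpha)) (ksub (embed alpha c 1) x).

Definition is_tent_tile (F : set (Kspace R r s)) : Prop :=
  [/\ F !=set0, compact (F : set ('rV[R]_r * 'rV[R[i]]_s)%type)
    & F = (fL @` F) `|` (fR @` F)].

Definition tent_subtile (p : nat) (F : set (Kspace R r s)) (k : nat) :
    set (Kspace R r s) :=
  if k == p.-1 then iter p.-1 fL @` F else (iter k fL \o fR) @` F.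

End TentTile.

Section Substitutions.
Variable n : nat.

(* A substitution over the alphabet {0, ..., n-1} is given by the images of
   the letters. *)
Implicit Types (zeta : 'I_n -> seq 'I_n) (W U V : seq 'I_n).

Definition is_substitution zeta : Prop := forall a, zeta a != [::].

Definition subst_word zeta W : seq 'I_n := flatten (map zeta W).

Definition ell W : 'cV[int]_n := \col_b (count_mem b W)%:Z.

Definition incidence_mx zeta : 'M[int]_n := \matrix_(i, j) ell (zeta j) i 0.

Definition primitive zeta : Prop :=
  is_substitution zeta /\
  exists2 k : nat, (1 <= k)%N
    & forall a b, 0 < ell (iter k (subst_word zeta) [:: a]) b 0.

Definition unimodular zeta : Prop :=
  \det (incidence_mx zeta) = 1 \/ \det (incidence_mx zeta) = -1.

(* [lam] is the Perron-Frobenius eigenvalue of the incidence matrix: the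
   positive eigenvalue exceeding the moduli of all other eigenvalues. *)
Definition dominant_root (R : realType) zeta (lam : R) : Prop :=
  [/\ 0 < lam, eigenvalue (map_mx intr (incidence_mx zeta) : 'M[R]_n) lam
    & forall mu : R[i],
        eigenvalue (map_mx intr (incidence_mx zeta) : 'M[R[i]]_n) mu ->
        mu != lam%:C%C -> `|mu| < lam%:C%C].

Definition pisot_substitution (R : realType) zeta : Prop :=
  exists2 lam : R, dominant_root zeta lam & pisot_number lam.

Definition positive_left_eigenvector (R : realType) zeta (lam : R)
    (nu : 'rV[R]_n) : Prop :=
  nu *m map_mx intr (incidence_mx zeta) = lam *: nu /\
  forall i, 0 < nu 0 i /\ Qadj lam (nu 0 i).

Definition g_map (R : realType) (r s : nat) (lam : R) (c : Kspace R r s)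
    (nu : 'rV[R]_n) U (x : Kspace R r s) : Kspace R r s :=
  kadd (embed lam c ((nu *m map_mx intr (ell U)) 0 0)) (kmul c x).

Definition is_rauzy_family (R : realType) (r s : nat) zeta (lam : R)
    (c : Kspace R r s) (nu : 'rV[R]_n) (Rz : 'I_n -> set (Kspace R r s)) :
  Prop :=
  forall a : 'I_n,
    [/\ Rz a !=set0, compact (Rz a : set ('rV[R]_r * 'rV[R[i]]_s)%type)
      & Rz a = [set x | exists b U V,
                  zeta b = U ++ a :: V /\ (g_map lam c nu U @` Rz b) x]].

End Substitutions.

(* The substitution 0 |-> 10, k |-> k+1 (1 <= k <= p-2), p-1 |-> (p-1)0 over
   {0, ..., p-1}, first on natural numbers. For 2 <= p all the numbers
   produced are < p, so the default value in [insubd] is never used. *)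
Definition zeta_nat (p k : nat) : seq nat :=
  if k == 0%N then [:: 1%N; 0%N]
  else if k == p.-1 then [:: p.-1; 0%N]
  else [:: k.+1].

Definition zeta (p : nat) (k : 'I_p) : seq 'I_p :=
  [seq insubd k j | j <- zeta_nat p k].

(* Main.v *)
(* Left eigenvectors of the incidence matrix of zeta_p for mu satisfy
   nu_1 = (mu - 1) nu_0, nu_k = mu^(k-1) nu_1 and nu_0 = (mu - 1) nu_(p-1), so
   the eigenvalues are the roots of mu^(p-2) (mu - 1)^2 = 1; for special Pisot
   units this equation is equivalent to alpha^p = beta^2.

   Substituting F = f_L F u f_R F into f_R F and using f_R f_R (x) =
   beta - beta^2 + alpha^p x and f_R f_L (x) = - alpha + alpha (beta - beta x),
   one sees that the sets X_k satisfy
     X_0 = (- alpha + alpha X_0) u (beta - beta^2 + alpha X_(p-1)),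
     X_(k+1) = alpha X_k,  X_(p-1) = alpha X_(p-2) u alpha X_(p-1),
   which are the equations of the Rauzy fractals up to the common scaling by
   - nu_1 / alpha and the choice of the enumeration of the conjugates.
   Contractive graph-directed systems have only one family of non-empty compact
   solutions. *)
Require Import Defs.
From mathcomp Require Import all_boot all_order all_algebra.
From mathcomp Require Import complex zify ring lra.
From mathcomp Require Import all_classical all_reals all_analysis.

Set Implicit Arguments.
Unset Strict Implicit.
Unset Printing Implicit Defensive.

Import Order.TTheory GRing.Theory Num.Theory.
Import numFieldNormedType.Exports.
Import Normc.

Local Open Scope classical_set_scope.
Local Open Scope ring_scope.

(** * Moduli of complex numbers as real numbers *)

Lemma norm_normc (R : rcfType) (z : R[i]) : `|z| = (normc z)%:C%C.
Proof. by case: z. Qed.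

Lemma sqr_normcE (R : rcfType) (z : R[i]) :
  normc z ^+ 2 = complex.Re z ^+ 2 + complex.Im z ^+ 2.
Proof. by case: z => a b /=; rewrite sqr_sqrtr // addr_ge0 ?sqr_ge0. Qed.

Lemma normc_ge0 (R : rcfType) (z : R[i]) : 0 <= normc z.
Proof. by case: z => a b; apply: sqrtr_ge0. Qed.

Lemma normcX (R : rcfType) (z : R[i]) k : normc (z ^+ k) = normc z ^+ k.
Proof. by elim: k => [|k IH]; rewrite ?normc1 // !exprS normcM IH. Qed.

(** * The substitution zeta_p *)

Section SubstitutionZeta.
Variable n : nat.
Let p := n.+3.
Implicit Types (a b : 'I_p) (U V W : seq 'I_p).

Lemma val_zeta b : map val (zeta b) = zeta_nat p b.
Proof.
rewrite /zeta -map_comp -[RHS]map_id; apply/eq_in_map => j /= jb.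
rewrite insubdK //; move: jb; rewrite /zeta_nat.
case: eqP => [_|b0]; last case: eqP => [_|bp]; rewrite !inE.
- by case/orP => /eqP->.
- by case/orP => /eqP->; rewrite -topredE /= /p; lia.
- by move=> /eqP->; rewrite -topredE /= /p; have := ltn_ord b; rewrite /p in b0 bp *; lia.
Qed.

(** These are the edges of the graph behind the Rauzy equations. Only the two edges into the letter
    0 carry a non-empty prefix, since only the images of 0 and [p-1] have a second letter. *)
Lemma zeta_split b U a V : zeta b = U ++ a :: V ->
  U = [::] /\ (val a = b.+1 \/ val a = n.+2 /\ val b = n.+2) \/
  exists u, [/\ U = [:: u], val a = 0%N
    & val b = 0%N /\ val u = 1%N \/ val b = n.+2 /\ val u = n.+2].
Proof.
move=> /(congr1 (map val)); rewrite val_zeta map_cat /= /zeta_nat.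
case: eqP => b0; last case: eqP => bp; case: U => [|u [|u' U]] //= [].
- by move=> <- _; left; split=> //; left; rewrite b0.
- by move=> uE aE _; right; exists u; split=> //; left.
- by move=> _ _; case: (map _ U).
- by move=> <- _; left; split=> //; right.
- by move=> uE aE _; right; exists u; split=> //; right; rewrite -uE.
- by move=> _ _; case: (map _ U).
- by move=> <- _; left; split=> //; left.
Qed.

Lemma zeta_succ a b : val a = b.+1 -> exists V, zeta b = a :: V.
Proof.
move=> ab; case def: (zeta b) (val_zeta b) => [|x V]; rewrite /zeta_nat.
  by case: eqP => //; case: eqP.
case: eqP => b0; last case: eqP => bp; move=> [xE _].
- by exists V; congr cons; apply: val_inj; rewrite /= xE ab b0.
- by have := ltn_ord a; rewrite ab bp ltnn.
- by exists V; congr cons; apply: val_inj; rewrite /= xE ab.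
Qed.

Lemma zeta0 a b u : val a = 0%N -> val b = 0%N -> val u = 1%N ->
  zeta b = [:: u; a].
Proof.
move=> a0 b0 u1; apply: (inj_map val_inj).
by rewrite val_zeta /zeta_nat b0 /= a0 u1.
Qed.

Lemma zeta_last a b : val a = 0%N -> val b = n.+2 -> zeta b = [:: b; a].
Proof.
move=> a0 bn; apply: (inj_map val_inj).
by rewrite val_zeta /zeta_nat /= a0 bn /= eqxx.
Qed.

Lemma zeta_mid a b : val b != 0%N -> val a = b.+1 -> zeta b = [:: a].
Proof.
move=> b0 ab; apply: (inj_map val_inj).
rewrite val_zeta /zeta_nat (negPf b0) /= ab ifF //.
by apply/negbTE/eqP => bn; have := ltn_ord a; rewrite ab bn ltnn.
Qed.

Lemma mem_iter_zeta k a b W : a \in iter k (subst_word (@zeta p)) W ->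
  b \in zeta a -> b \in iter k.+1 (subst_word (@zeta p)) W.
Proof. by move=> aW ba; apply/flattenP; exists (zeta a) => //; apply: map_f. Qed.

Lemma mem_iter_zeta_add k i a b W :
    a \in iter k (subst_word (@zeta p)) W -> val b = (a + i)%N ->
  b \in iter (k + i) (subst_word (@zeta p)) W.
Proof.
move=> aW; elim: i b => [|i IH] b; first by rewrite !addn0 => /val_inj->.
rewrite !addnS => bE; have lt_ai : (a + i < p)%N.
  by have := ltn_ord b; rewrite bE => /ltnW.
have h := IH (Ordinal lt_ai) erefl.
apply: mem_iter_zeta h _.
by have [V ->] := @zeta_succ b (Ordinal lt_ai) bE; rewrite mem_head.
Qed.

(** Letters climb one by one up to [p-1], whose image contains 0. From then on 0 reproduces itself
    and can climb to any letter, so the exponent [2p] suits all pairs. *)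
Lemma zeta_primitive : primitive (@zeta p).
Proof.
split=> [a|].
  apply/eqP => /(congr1 (map val)); rewrite val_zeta /zeta_nat.
  by case: ifP => // _; case: ifP.
exists (p + p)%N => // a b.
rewrite mxE ltz_nat -has_count has_pred1.
pose o : 'I_p := ord0.
have stay k m W : (k <= m)%N -> o \in iter k (subst_word (@zeta p)) W ->
    o \in iter m (subst_word (@zeta p)) W.
  move=> /subnKC <- oW; elim: (m - k)%N => [|i IH]; first by rewrite addn0.
  rewrite addnS; apply: mem_iter_zeta IH _.
  by rewrite (@zeta0 o o (Ordinal (isT : 1 < p)%N)) // !inE eqxx orbT.
have o_in : o \in iter p (subst_word (@zeta p)) [:: a].
  have [a0|a0] := eqVneq a o.
    by apply: (@stay 0%N) => //; rewrite a0 mem_head.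
  have ap : (a <= n.+2)%N by rewrite -ltnS.
  have : (ord_max : 'I_p) \in iter (0 + (n.+2 - a)) (subst_word (@zeta p)) [:: a].
    apply: (@mem_iter_zeta_add _ _ a); first exact: mem_head.
    by rewrite /= subnKC.
  move=> /mem_iter_zeta h.
  apply: (@stay (0 + (n.+2 - a)).+1); first by rewrite add0n ltnS leq_subr.
  by apply/h; rewrite (@zeta_last o) // !inE eqxx orbT.
have bp : (b <= p)%N by apply: ltnW.
(* The letter 0 waits for [p - b] steps, then climbs to [b] in [b] steps. *)
have -> : (p + p = p + (p - b) + b)%N by rewrite -addnA subnK.
by apply: (@mem_iter_zeta_add _ _ o); first by apply: stay o_in; rewrite leq_addr.
Qed.

Lemma mul_ell (K : pzRingType) (nu : 'rV[K]_p) W :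
  (nu *m map_mx intr (ell W)) 0 0 = \sum_(a <- W) nu 0 a.
Proof.
rewrite mxE.
under eq_bigr do rewrite !mxE.
elim: W => [|a W IH]; first by rewrite big_nil big1 // => i _; rewrite mulr0.
rewrite big_cons -IH (bigD1 a) //= [in RHS](bigD1 a) //= eqxx addrA.
rewrite [in LHS]PoszD rmorphD /= mulrDr mulr1; congr (_ + _).
by apply: eq_bigr => i /negPf ia; rewrite eq_sym ia add0n.
Qed.

Lemma mul_incidence (K : pzRingType) (nu : 'rV[K]_p) b :
  (nu *m map_mx intr (incidence_mx (@zeta p))) 0 b = \sum_(a <- zeta b) nu 0 a.
Proof.
rewrite -mul_ell !mxE; apply: eq_bigr => i _; rewrite !mxE //.
Qed.

(** One equation per column. The right-hand side [w] is arbitrary so that the same equations give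
    both the eigenvectors and the inverse matrix. *)
Lemma mul_incidenceP (K : pzRingType) (nu w : 'rV[K]_p) :
  reflect [/\ nu 0 (inord 1) + nu 0 (inord 0) = w 0 (inord 0),
              nu 0 (inord n.+2) + nu 0 (inord 0) = w 0 (inord n.+2)
            & forall k, (0 < k < n.+2)%N -> nu 0 (inord k.+1) = w 0 (inord k)]
    (nu *m map_mx intr (incidence_mx (@zeta p)) == w).
Proof.
have s0 : zeta (inord 0 : 'I_p) = [:: inord 1; inord 0].
  by apply: zeta0; rewrite /= inordK.
have sn : zeta (inord n.+2 : 'I_p) = [:: inord n.+2; inord 0].
  by apply: zeta_last; rewrite /= inordK.
have sk k : (0 < k < n.+2)%N -> zeta (inord k : 'I_p) = [:: inord k.+1].
  move=> /andP[k0 kn]; apply: zeta_mid;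
    by rewrite /= !inordK ?ltnS // ?(ltnW kn) // -lt0n.
apply: (iffP eqP) => [<-|[h0 hn hk]].
  split=> [||k kn]; rewrite mul_incidence ?s0 ?sn ?sk //;
    by rewrite !big_cons big_nil addr0.
apply/rowP => b; rewrite mul_incidence -(inord_val b).
have [b0|b0] := posnP b; first by rewrite b0 s0 !big_cons big_nil addr0.
have [bn|bn] := eqVneq (val b) n.+2; first by rewrite bn sn !big_cons big_nil addr0.
have bk : (0 < b < n.+2)%N by rewrite b0 ltn_neqAle bn -ltnS ltn_ord.
by rewrite sk // big_seq1 hk.
Qed.

(** An integral inverse makes the determinant a unit of the integers. *)
Lemma zeta_unimodular : unimodular (@zeta p).
Proof.
(* Row [i] solves the equations of [mul_incidenceP] for the [i]-th unit vector, whose entries are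
   [d k]: entries from 2 on are shifted ones, the last column then gives entry 0, namely [v], and
   the first column gives entry 1. *)
pose N : 'M[int]_p := \matrix_(i, j)
  (let d k := (val i == k)%:R in
   let v := d n.+2 - d n.+1 in
   if val j == 0%N then v else if val j == 1%N then d 0%N - v else d (val j).-1).
have NM : N *m incidence_mx (@zeta p) = 1%:M.
  apply/row_matrixP => i; rewrite row_mul.
  have -> : incidence_mx (@zeta p) = map_mx intr (incidence_mx (@zeta p)).
    by apply/matrixP => x y; rewrite [RHS]mxE intz.
  have eqi k : (k < p)%N -> (i == inord k) = (val i == k).
    by move=> kp; rewrite -val_eqE /= inordK.
  apply/eqP/mul_incidenceP; rewrite !mxE !eqi //= !inordK //=.
  split=> [||k /andP[k0 kn]]; rewrite ?subrK //.
  - by rewrite addrC subrK.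
  - have kp : (k < p)%N by rewrite ltnW.
    by rewrite !mxE eqi //= !inordK //= eqSS (gtn_eqF k0).
have [_] := mulmx1_unit NM.
by rewrite unitmxE => /orP[] /eqP; [left|right].
Qed.

Lemma eigenvector_zeta (K : comPzRingType) (nu : 'rV[K]_p) (mu : K) :
    nu *m map_mx intr (incidence_mx (@zeta p)) = mu *: nu ->
  [/\ forall k, (k <= n.+1)%N -> nu 0 (inord k.+1) = mu ^+ k * nu 0 (inord 1),
      nu 0 (inord 1) = (mu - 1) * nu 0 (inord 0)
    & nu 0 (inord 0) = (mu - 1) * nu 0 (inord n.+2)].
Proof.
move=> /eqP /mul_incidenceP; rewrite !mxE => -[h0 hn hk].
split.
- elim=> [|k IH] kn; first by rewrite mul1r.
  by rewrite hk // mxE IH 1?ltnW // exprS mulrA.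
- by rewrite mulrBl mul1r -h0 addrK.
- by rewrite mulrBl mul1r -hn addrC addKr.
Qed.

(** Running once through the equations of [eigenvector_zeta] multiplies [nu_0] by
    [mu^(p-2) (mu-1)^2], and [nu_0 = 0] forces [nu = 0]. *)
Lemma eigenvalue_zeta (K : fieldType) (mu : K) :
  eigenvalue (map_mx intr (incidence_mx (@zeta p))) mu =
  (mu ^+ n.+1 * (mu - 1) ^+ 2 == 1).
Proof.
apply/eigenvalueP/eqP => [[nu] nuM|mu1].
  have [hk h1 h0] := eigenvector_zeta nuM.
  have nu00 : nu 0 (inord 0) = mu ^+ n.+1 * (mu - 1) ^+ 2 * nu 0 (inord 0).
    by rewrite {1}h0 hk // {1}h1; ring.
  have [z nu0|nz _] := eqVneq (nu 0 (inord 0)) 0; last first.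
    by apply: (mulIf nz); rewrite -nu00 mul1r.
  case/eqP: nu0; apply/rowP => i; rewrite mxE -(inord_val i).
  have := ltn_ord i; case: (val i) => [//|k] kn.
  by rewrite hk // h1 z !mulr0.
(* The solution normalised by [nu_0 = 1]; the equation on [mu] is exactly what the last column
   demands. *)
exists (\row_j if val j == 0%N then 1 else mu ^+ (val j).-1 * (mu - 1)).
  apply/eqP/mul_incidenceP; rewrite !mxE /= !inordK //=.
  split=> [||k /andP[k0 kn]].
  - by ring.
  - by rewrite -[X in _ + X]mu1; ring.
  - rewrite !mxE /= !inordK ?ltnS ?(ltnW kn) //= (gtn_eqF k0).
    by rewrite mulrA -exprS prednK.
by apply/eqP => /rowP /(_ 0); rewrite !mxE => /eqP; rewrite oner_eq0.
Qed.

(* A root of [mu ^ (p - 2) * (mu - 1) ^ 2 = 1] with [|mu| >= alpha] satisfies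
   [|mu - 1| >= alpha - 1], so both are equalities and [mu] is real positive. *)
Lemma dominant_root_zeta (R : realType) (alpha : R) : 1 < alpha ->
  alpha ^+ n.+1 * (alpha - 1) ^+ 2 = 1 -> dominant_root (@zeta p) alpha.
Proof.
move=> a1 aE; have a0 : 0 < alpha by apply: lt_trans a1.
have b0 : 0 < alpha - 1 by rewrite subr_gt0.
split=> // [|mu]; rewrite eigenvalue_zeta; first exact/eqP.
move=> /eqP muE mu_neq; rewrite norm_normc ltcR ltNge; apply/negP => le_am.
have : normc mu ^+ n.+1 * normc (mu - 1) ^+ 2 = 1.
  by rewrite -!normcX -normcM muE normc1.
have le_m1 : normc mu - 1 <= normc (mu - 1).
  rewrite lerBlDr; have := le_normcD (mu - 1) 1.
  by rewrite normc1 subrK.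
have le_b : alpha - 1 <= normc (mu - 1).
  by apply: le_trans le_m1; rewrite lerB.
have le_b2 : (alpha - 1) ^+ 2 <= normc (mu - 1) ^+ 2.
  by rewrite lerXn2r // nnegrE ?normc_ge0 ?ltW.
have le_ak : alpha ^+ n.+1 <= normc mu ^+ n.+1.
  by rewrite lerXn2r // nnegrE ?normc_ge0 ?ltW.
rewrite -aE => E.
have m0 : 0 < normc mu by apply: lt_le_trans le_am.
have [lt_am|] := ltP alpha (normc mu).
  have : alpha ^+ n.+1 * (alpha - 1) ^+ 2 < normc mu ^+ n.+1 * normc (mu - 1) ^+ 2.
    apply: (@lt_le_trans _ _ (normc mu ^+ n.+1 * (alpha - 1) ^+ 2)).
      by rewrite ltr_pM2r ?exprn_gt0 // ltrXn2r // ltW.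
    by rewrite ler_pM2l // exprn_gt0.
  by rewrite E ltxx.
move=> le_ma; have am : normc mu = alpha by apply/le_anti/andP.
move: E; rewrite am => /(mulfI (lt0r_neq0 (exprn_gt0 _ a0))) E.
case/eqP: mu_neq; move: E; rewrite sqr_normcE.
have := congr1 (fun x => x ^+ 2) am; rewrite sqr_normcE.
case: mu {muE le_am le_m1 le_b le_b2 le_ak m0 le_ma am} => x y /= E1 E2.
(* Subtracting [(x-1)^2 + y^2 = (alpha-1)^2] from [x^2 + y^2 = alpha^2] leaves [2x = 2 alpha]. *)
have xa : x = alpha.
  by move: E1 E2; rewrite oppr0 addr0; nra.
by move: E1; rewrite xa => /eqP; rewrite -subr_eq0 addrC addKr sqrf_eq0 => /eqP->.
Qed.

End SubstitutionZeta.
(** * Conjugate embeddings of Q(x) *)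

Section ConjugateImage.
Variables (R : realType) (x : R).
Implicit Types (y : R[i]) (z : R) (q : {poly rat}).

(** At a root of the irreducible [m], [q] vanishes exactly when [m] divides [q], since otherwise the
    two are coprime. This criterion is the same at [x] and at [y]. *)
Lemma galois_conj_root y q : galois_conj x y ->
  root (map_poly ratr q) x = root (map_poly ratr q) y.
Proof.
case=> m [m_irr mx my].
have rootP (F : numFieldType) (t : F) : root (map_poly ratr m) t ->
    root (map_poly ratr q) t = (m %| q)%R.
  move=> mt; apply/idP/idP => [qt|/dvdpP[u ->]]; last first.
    by rewrite rmorphM rootM mt orbT.
  have [cop|] := boolP (coprimep m q).
    have cop' : coprimep (map_poly (ratr : rat -> F) m) (map_poly ratr q).
      by rewrite coprimep_map.
    by have := coprimep_root cop' mt; rewrite -[_ == 0]/(root _ t) qt.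
  rewrite -gcdp_eqp1 -size_poly_eq1 => sg.
  have /eqp_dvdl <- := m_irr.2 _ sg (dvdp_gcdl _ _).
  exact: dvdp_gcdr.
by rewrite (rootP R) // (rootP R[i]).
Qed.

(** Well-definedness: the polynomial chosen by [xget] differs from [q] by one that vanishes at [x],
    hence at [y]. The default 0 is excluded because [q] is a candidate. *)
Lemma conj_imageE y q : galois_conj x y ->
  conj_image x y (map_poly ratr q).[x] = (map_poly ratr q).[y].
Proof.
move=> xy; rewrite /conj_image; case: xgetP => [q' _ /= qE|/(_ q)]; last by case.
apply/eqP; rewrite -subr_eq0 -hornerN -hornerD -rmorphN -rmorphD /=.
rewrite -[_ == 0]/(root _ y) -galois_conj_root // rmorphD rmorphN /=.
by rewrite /root hornerD hornerN -qE subrr.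
Qed.

Lemma conj_imageD y z1 z2 : galois_conj x y -> Qadj x z1 -> Qadj x z2 ->
  conj_image x y (z1 + z2) = conj_image x y z1 + conj_image x y z2.
Proof.
move=> xy [q1 ->] [q2 ->].
by rewrite -hornerD -rmorphD !conj_imageE // rmorphD hornerD.
Qed.

Lemma conj_imageM y z1 z2 : galois_conj x y -> Qadj x z1 -> Qadj x z2 ->
  conj_image x y (z1 * z2) = conj_image x y z1 * conj_image x y z2.
Proof.
move=> xy [q1 ->] [q2 ->].
by rewrite -hornerM -rmorphM !conj_imageE // rmorphM hornerM.
Qed.

Lemma conj_imageN y z : galois_conj x y -> Qadj x z ->
  conj_image x y (- z) = - conj_image x y z.
Proof.
by move=> xy [q ->]; rewrite -hornerN -rmorphN !conj_imageE // rmorphN hornerN.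
Qed.

Lemma conj_image_rat y a : galois_conj x y ->
  conj_image x y (ratr a) = ratr a.
Proof.
move=> xy; have := @conj_imageE y a%:P xy.
by rewrite !map_polyC !hornerC.
Qed.

Lemma conj_image1 y : galois_conj x y -> conj_image x y 1 = 1.
Proof. by move=> /(@conj_image_rat _ 1); rewrite !rmorph1. Qed.

Lemma conj_image0 y : galois_conj x y -> conj_image x y 0 = 0.
Proof. by move=> /(@conj_image_rat _ 0); rewrite !rmorph0. Qed.

Lemma conj_image_id y : galois_conj x y -> conj_image x y x = y.
Proof.
by move=> xy; have := @conj_imageE y 'X xy; rewrite !map_polyX !hornerX.
Qed.

Lemma conj_image_eq0 y z : galois_conj x y -> Qadj x z ->
  (conj_image x y z == 0) = (z == 0).
Proof.
by move=> xy [q ->]; rewrite conj_imageE // -[LHS]/(root _ _) -galois_conj_root.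
Qed.

(** The embedding of the reals fixes rational coefficients, so real conjugates may be handled as
    complex ones. *)
Lemma conj_image_real (t z : R) : (conj_image x t z)%:C%C = conj_image x t%:C%C z.
Proof.
rewrite /conj_image -horner_map -map_poly_comp; congr (_.[_]).
by apply: eq_map_poly => a; apply: fmorph_rat.
Qed.

Lemma conj_image_conjc y z : conj_image x (conjc y) z = conjc (conj_image x y z).
Proof.
rewrite /conj_image -horner_map -map_poly_comp; congr (_.[_]).
by apply: eq_map_poly => a /=; rewrite (fmorph_rat (conjc : {rmorphism R[i] -> R[i]})).
Qed.

Lemma Qadj_rat a : Qadj x (ratr a).
Proof. by exists a%:P; rewrite map_polyC hornerC. Qed.

Lemma Qadj_id : Qadj x x.
Proof. by exists 'X; rewrite map_polyX hornerX. Qed.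

Lemma QadjD z1 z2 : Qadj x z1 -> Qadj x z2 -> Qadj x (z1 + z2).
Proof. by move=> [q1 ->] [q2 ->]; exists (q1 + q2); rewrite rmorphD hornerD. Qed.

Lemma QadjM z1 z2 : Qadj x z1 -> Qadj x z2 -> Qadj x (z1 * z2).
Proof. by move=> [q1 ->] [q2 ->]; exists (q1 * q2); rewrite rmorphM hornerM. Qed.

Lemma QadjN z : Qadj x z -> Qadj x (- z).
Proof. by move=> [q ->]; exists (- q); rewrite rmorphN hornerN. Qed.

Lemma Qadj1 : Qadj x 1.
Proof. by rewrite -(rmorph1 (@ratr R)); apply: Qadj_rat. Qed.

Lemma QadjX z k : Qadj x z -> Qadj x (z ^+ k).
Proof. by move=> xz; elim: k => [|k]; [exact: Qadj1|rewrite exprS; exact: QadjM]. Qed.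

End ConjugateImage.
(** * Coordinates and norm on R^r x C^s *)

Section Coordinates.
Variables (R : realType) (r s : nat).
Implicit Types (x y z : Kspace R r s) (k : ('I_r + 'I_s)%type).

(** Real coordinates are also viewed in [R[i]], so that identities can be checked coordinate by
    coordinate in a single field. *)
Definition kc x k : R[i] :=
  match k with inl i => (x.1 0 i)%:C%C | inr j => x.2 0 j end.

Definition knorm x : R := \sum_k normc (kc x k).

(** Closedness in terms of distances; with [kbounded] it is all that the uniqueness argument retains
    of compactness. *)
Definition kclosed (A : set (Kspace R r s)) : Prop :=
  forall x, (forall e, 0 < e -> exists2 y, A y & knorm (ksub x y) < e) -> A x.

Definition kbounded (A : set (Kspace R r s)) : Prop :=
  exists M, forall x, A x -> knorm x <= M.

Lemma kcP x y : kc x =1 kc y -> x = y.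
Proof.
case: x y => [x1 x2] [y1 y2] e; congr pair; apply/rowP => i.
  by have := e (inl i) => /= -[].
exact: (e (inr i)).
Qed.

Lemma kc_add x y k : kc (Defs.kadd x y) k = kc x k + kc y k.
Proof. by case: k => i /=; rewrite mxE // rmorphD. Qed.

Lemma kc_sub x y k : kc (ksub x y) k = kc x k - kc y k.
Proof. by case: k => i /=; rewrite !mxE // rmorphB. Qed.

Lemma kc_mul x y k : kc (kmul x y) k = kc x k * kc y k.
Proof. by case: k => i /=; rewrite mxE // rmorphM. Qed.

Lemma kc_scale a x k : kc (kscale a x) k = a%:C%C * kc x k.
Proof. by case: k => i /=; rewrite mxE // rmorphM. Qed.

Lemma kc_embed (t : R) (c : Kspace R r s) (u : R) k :
  kc (embed t c u) k = conj_image t (kc c k) u.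
Proof. by case: k => i /=; rewrite mxE // conj_image_real. Qed.

Lemma knorm_ge0 x : 0 <= knorm x.
Proof. by apply: sumr_ge0 => k _; apply: normc_ge0. Qed.

Lemma kc_le_knorm x k : normc (kc x k) <= knorm x.
Proof.
rewrite /knorm (bigD1 k) //= lerDl; apply: sumr_ge0 => l _; exact: normc_ge0.
Qed.

Lemma knorm_eq0 x y : knorm (ksub x y) = 0 -> x = y.
Proof.
move=> xy0; apply: kcP => k; apply/eqP; rewrite -subr_eq0 -kc_sub; apply/eqP.
apply: eq0_normc; apply/le_anti; rewrite normc_ge0 andbT -xy0.
exact: kc_le_knorm.
Qed.

Lemma knorm_le_sub x y : knorm (ksub x y) <= knorm x + knorm y.
Proof.
rewrite -big_split; apply: ler_sum => k _ /=; rewrite !kc_sub.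
by rewrite -[normc (kc y k)]normcN; apply: le_normcD.
Qed.

(** The triangle inequality makes the map 1-Lipschitz. Balls of [R[i]] have radii in [R[i]], hence
    the embedded [e]. *)
Lemma normc_continuous (z : R[i]) : continuous (fun w : R[i] => normc (w - z)).
Proof.
move=> w; have nw : Filter (nbhs w) by apply: nbhs_filter.
apply/cvgrPdist_lt => e e0.
apply/nbhs_ballP; exists e%:C%C => [|t]; first by rewrite /= ltcR.
rewrite /ball /= norm_normc ltcR; apply: le_lt_trans.
rewrite ler_norml lerBlDr lerBrDl lerBlDl; apply/andP; split.
  rewrite -[normc (w - t)]normcN.
  have -> : t - z = - (w - t) + (w - z) by rewrite opprB addrA subrK.
  exact: le_normcD.
have -> : w - z = w - t + (t - z) by rewrite addrA subrK.
exact: le_normcD.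
Qed.

Lemma knorm_continuous x :
  continuous (fun y : ('rV[R]_r * 'rV[R[i]]_s)%type => knorm (ksub y x)).
Proof.
apply: continuous_big => [|k _]; first exact: add_continuous.
move=> y; case: k => i.
  have -> : (fun y => normc (kc (ksub y x) (inl i))) =
            (fun y : ('rV[R]_r * 'rV[R[i]]_s)%type => `|y.1 0 i - x.1 0 i|).
    by apply/funext => t; rewrite kc_sub /= subr0 expr0n addr0 sqrtr_sqr.
  apply: (@continuous_comp _ _ _
    (fun y : ('rV[R]_r * 'rV[R[i]]_s)%type => y.1 0 i)
    (fun w => `|w - x.1 0 i|)); last first.
    apply: continuous_comp (@norm_continuous _ R _).
    by apply: cvgB; [exact: cvg_id|exact: cvg_cst].
  apply: (@continuous_comp _ _ _ fst (fun M : 'rV[R]_r => M 0 i)).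
    exact: cvg_fst.
  exact: coord_continuous.
under eq_fun do rewrite kc_sub.
apply: (@continuous_comp _ _ _ (fun y : ('rV[R]_r * 'rV[R[i]]_s)%type => y.2 0 i)
   (fun w => normc (w - x.2 0 i))); last exact: normc_continuous.
apply: (@continuous_comp _ _ _ snd (fun M : 'rV[R[i]]_s => M 0 i)).
  exact: cvg_snd.
exact: coord_continuous.
Qed.

(* Compactness in the product topology is only used through the images in [R]
   of the functions [y |-> knorm (y - x)]: they are bounded, and contain [0] as
   soon as they contain arbitrarily small values. *)
Lemma compact_knorm (A : set (Kspace R r s)) x :
  compact (A : set ('rV[R]_r * 'rV[R[i]]_s)%type) ->
  compact [set knorm (ksub y x) | y in A].
Proof.
apply: continuous_compact; apply: continuous_subspaceT; exact: knorm_continuous.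
Qed.

Lemma compact_kbounded (A : set (Kspace R r s)) :
  compact (A : set ('rV[R]_r * 'rV[R[i]]_s)%type) -> kbounded A.
Proof.
(* The base point is the origin, written as a difference so that [kc_sub] makes its coordinates
   vanish. *)
move=> /(@compact_knorm _ (ksub (0, 0) (0, 0))) /compact_bounded [M [_ hM]].
exists (M + 1) => x Ax.
have -> : knorm x = knorm (ksub x (ksub (0, 0) (0, 0))).
  by apply: eq_bigr => k _; rewrite !kc_sub subrr subr0.
apply: le_trans (ler_norm _) _; apply: (hM (M + 1)); first by rewrite ltrDl.
by exists x.
Qed.

Lemma compact_kclosed (A : set (Kspace R r s)) :
  compact (A : set ('rV[R]_r * 'rV[R[i]]_s)%type) -> kclosed A.
Proof.
move=> cA x xA; have cl := compact_closed (@Rhausdorff R) (compact_knorm (x := x) cA).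
have [y Ay /knorm_eq0 <- //] : [set knorm (ksub y x) | y in A] 0.
apply: cl => B /nbhs_ballP [e /= e0 eB].
have [y Ay xy] := xA e e0.
exists (knorm (ksub y x)); split; first by exists y.
apply: eB; rewrite /ball /= sub0r normrN ger0_norm ?knorm_ge0 //.
suff -> : knorm (ksub y x) = knorm (ksub x y) by [].
by apply: eq_bigr => k _; rewrite !kc_sub -normcN opprB.
Qed.

End Coordinates.
(** * Attractors of contractive systems *)

Section Similarities.
Variable R : realType.

Definition klipschitz (r s r' s' : nat) (G : Kspace R r s -> Kspace R r' s') :=
  exists2 C, 0 < C
    & forall x y, knorm (ksub (G x) (G y)) <= C * knorm (ksub x y).

(** Bi-Lipschitz bijections, not isometries: they transport [kbounded] and [kclosed], and [fL], [fR]
    and changes of enumeration are all of this kind. *)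
Definition kiso (r s r' s' : nat) (G : Kspace R r s -> Kspace R r' s') :=
  exists H, [/\ klipschitz G, klipschitz H, cancel G H & cancel H G].

Lemma kiso_comp (r s r' s' r'' s'' : nat) (G : Kspace R r' s' -> Kspace R r'' s'')
    (G' : Kspace R r s -> Kspace R r' s') :
  kiso G -> kiso G' -> kiso (G \o G').
Proof.
have lip_comp r1 s1 r2 s2 r3 s3 (K : Kspace R r2 s2 -> Kspace R r3 s3)
    (K' : Kspace R r1 s1 -> Kspace R r2 s2) :
    klipschitz K -> klipschitz K' -> klipschitz (K \o K').
  move=> [C C0 KC] [C' C'0 K'C]; exists (C * C'); first exact: mulr_gt0.
  move=> x y; apply: le_trans (KC _ _) _.
  by rewrite -mulrA ler_pM2l.
move=> [H [lG lH GK HK]] [H' [lG' lH' GK' HK']]; exists (H' \o H); split.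
- exact: lip_comp.
- exact: lip_comp.
- exact: can_comp.
- exact: can_comp.
Qed.

Lemma kiso_id (r s : nat) : kiso (id : Kspace R r s -> _).
Proof. by exists id; split=> //; exists 1 => // x y; rewrite mul1r. Qed.

Lemma kiso_iter (r s : nat) (G : Kspace R r s -> Kspace R r s) k :
  kiso G -> kiso (iter k G).
Proof.
move=> kG; elim: k => [|k IH]; first exact: kiso_id.
exact: (kiso_comp kG IH).
Qed.

Lemma kiso_kbounded (r s r' s' : nat) (G : Kspace R r s -> Kspace R r' s') A :
  kiso G -> kbounded A -> kbounded (G @` A).
Proof.
move=> [_ [[C C0 GC] _ _ _]] [M AM].
exists (knorm (G (0, 0)) + C * (M + knorm ((0, 0) : Kspace R r s))) => _ [x Ax <-].
apply: (@le_trans _ _ (knorm (G (0, 0)) + knorm (ksub (G x) (G (0, 0))))).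
  rewrite -big_split; apply: ler_sum => k _ /=; rewrite !kc_sub.
  by apply: le_trans (le_normcD _ _); rewrite addrC subrK.
rewrite lerD2l; apply: le_trans (GC _ _) _; rewrite ler_pM2l //.
by apply: le_trans (knorm_le_sub _ _) _; rewrite lerD2r AM.
Qed.

(** The inverse is Lipschitz, so approximations of [y] in the image pull back to approximations of
    [H y] in [A]. *)
Lemma kiso_kclosed (r s r' s' : nat) (G : Kspace R r s -> Kspace R r' s') A :
  kiso G -> kclosed A -> kclosed (G @` A).
Proof.
move=> [H [_ [C C0 HC] GK HK]] cA y yGA; exists (H y) => //; apply: cA => e e0.
have [|_ [x Ax <-] yx] := yGA (e / C); first exact: divr_gt0.
exists x => //; rewrite -(GK x); apply: le_lt_trans (HC _ _) _.
by rewrite mulrC -ltr_pdivlMr.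
Qed.

(** The constant is the largest modulus of a coordinate of [w]; a maximum over finitely many values
    below 1 stays below 1, and the base value 0 covers an empty set of coordinates. *)
Lemma knorm_mul_le (r s : nat) (w : Kspace R r s) :
  exists2 C, 0 <= C /\ ((forall k, normc (kc w k) < 1) -> C < 1)
    & forall x y, knorm (ksub (kmul w x) (kmul w y)) <= C * knorm (ksub x y).
Proof.
exists (\big[Order.max/0]_k normc (kc w k)).
  by split=> [|lt1]; [exact: bigmax_ge_id|exact: bigmax_lt].
move=> x y; rewrite mulr_sumr; apply: ler_sum => k _.
rewrite !kc_sub !kc_mul -mulrBr normcM; apply: ler_wpM2r; first exact: normc_ge0.
exact: le_bigmax.
Qed.

Lemma kiso_mul (r s : nat) (w : Kspace R r s) :
  (forall k, kc w k != 0) -> kiso (kmul w).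
Proof.
move=> w0; pose w' : Kspace R r s := (map_mx GRing.inv w.1, map_mx GRing.inv w.2).
have kc_w' k : kc w' k = (kc w k)^-1.
  by case: k => i /=; rewrite mxE // fmorphV.
(* The constant [C] may be 0, while [klipschitz] asks for a positive one. *)
have lip (v : Kspace R r s) : klipschitz (kmul v).
  have [C [C0 _] vC] := knorm_mul_le v; exists (C + 1); first by rewrite ltr_wpDl.
  move=> x y; rewrite mulrDl mul1r; apply: le_trans (vC x y) _.
  by rewrite lerDl knorm_ge0.
exists (kmul w'); split=> // x; apply: kcP => k; rewrite !kc_mul kc_w'.
  by rewrite mulKf.
by rewrite mulVKf.
Qed.

Lemma kiso_reflect (r s : nat) (t : Kspace R r s) : kiso (ksub t).
Proof.
have lip : klipschitz (ksub t).
  exists 1 => // x y; rewrite mul1r /knorm; apply: ler_sum => k _.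
  rewrite !kc_sub.
  have -> : kc t k - kc x k - (kc t k - kc y k) = - (kc x k - kc y k) by ring.
  by rewrite normcN.
by exists (ksub t); split=> // x; apply: kcP => k; rewrite !kc_sub; ring.
Qed.

(** Half of the uniqueness of attractors; exchanging [A] and [B] gives the other half. [T a b]
    collects the translations along the edges from [b] to [a]. Iterating the contraction brings [A]
    arbitrarily close to the closed family [B]. *)
Lemma attractor_subset (r s : nat) (I : finType) (c : Kspace R r s)
    (T : I -> I -> set (Kspace R r s)) (A B : I -> set (Kspace R r s)) :
    (forall k, normc (kc c k) < 1) ->
    (forall a, kbounded (A a)) ->
    (forall a, [/\ B a !=set0, kbounded (B a) & kclosed (B a)]) ->
    (forall a x, A a x ->
      exists b t y, [/\ T a b t, A b y & x = Defs.kadd t (kmul c y)]) ->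
    (forall a b t y, T a b t -> B b y -> B a (Defs.kadd t (kmul c y))) ->
  forall a, A a `<=` B a.
Proof.
move=> c1 bA hB subA supB.
have unif (E : I -> set (Kspace R r s)) : (forall a, kbounded (E a)) ->
    exists2 M, 0 <= M & forall a x, E a x -> knorm x <= M.
  move=> /choice[f fE]; exists (\sum_a `|f a|) => [|a x Ex].
    exact: sumr_ge0.
  apply: le_trans (fE _ _ Ex) _; apply: le_trans (ler_norm _) _.
  by rewrite (bigD1 a) //= lerDl sumr_ge0.
have [MA MA0 hMA] := unif _ bA.
have [MB MB0 hMB] := unif B (fun a => let: And3 _ h _ := hB a in h).
have [rho [rho0 /(_ c1) rho1] hrho] := knorm_mul_le c.
(* Unfold [x] along one branch, approximate its preimage in [B], and apply the same branch to the
   approximation: the error shrinks by [rho]. *)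
have approx m a x : A a x ->
    exists2 y, B a y & knorm (ksub x y) <= rho ^+ m * (MA + MB).
  elim: m a x => [|m IH] a x Ax.
    have [[y By] _ _] := hB a; exists y => //; rewrite mul1r.
    by apply: le_trans (knorm_le_sub _ _) _; rewrite lerD ?(hMA a) ?(hMB a).
  have [b [t [x' [Tt Ax' ->]]]] := subA a x Ax.
  have [y' By' le_y'] := IH _ _ Ax'.
  exists (Defs.kadd t (kmul c y')); first exact: supB Tt By'.
  have -> : knorm (ksub (Defs.kadd t (kmul c x')) (Defs.kadd t (kmul c y'))) =
            knorm (ksub (kmul c x') (kmul c y')).
    apply: eq_bigr => k _; rewrite !kc_sub !kc_add; congr normc.
    by rewrite opprD addrACA subrr add0r.
  apply: le_trans (hrho _ _) _.
  by rewrite exprS -mulrA ler_wpM2l.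
move=> a x Ax; have [_ _ cB] := hB a; apply: cB => e e0.
(* Both bounds may be 0; adding 1 makes the divisor positive. *)
have M0 : 0 < MA + MB + 1 by rewrite ltr_wpDl // addr_ge0.
have [m lt_m] : exists m, rho ^+ m < e / (MA + MB + 1).
  have : (fun m => rho ^+ m) @ \oo --> (0 : R).
    by apply: cvg_expr; rewrite ger0_norm.
  move=> /cvgrPdist_lt /(_ (e / (MA + MB + 1)) (divr_gt0 e0 M0)) [m _ hm].
  exists m; have := hm m (leqnn m).
  by rewrite /= sub0r normrN ger0_norm // exprn_ge0.
have [y By le_y] := approx m a x Ax; exists y => //.
apply: le_lt_trans le_y _; apply: (@le_lt_trans _ _ (rho ^+ m * (MA + MB + 1))).
  by rewrite ler_wpM2l ?exprn_ge0 // lerDl.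
by rewrite -ltr_pdivlMr.
Qed.

End Similarities.
(** * Two enumerations of the conjugates *)

Section ConjugateCoordinates.
Variables (R : realType) (t : R).

(** Two enumerations may differ by a permutation and by the member chosen from each pair of complex
    conjugates; the boolean records that choice. *)
Definition conjc_if (b : bool) (z : R[i]) : R[i] := if b then conjc z else z.

Lemma conjc_ifK a b z : conjc_if a (conjc_if b z) = conjc_if (a (+) b) z.
Proof. by case: a b => [] [] //=; rewrite conjcK. Qed.

Lemma conj_image_conjc_if b y u :
  conj_image t (conjc_if b y) u = conjc_if b (conj_image t y u).
Proof. by case: b => //=; rewrite conj_image_conjc. Qed.

Lemma normc_conjc_if b z : normc (conjc_if b z) = normc z.
Proof. by case: b z => [] [x y] //=; rewrite sqrrN. Qed.

Lemma mem_conj_seq (r s : nat) (c : Kspace R r s) :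
  [/\ forall i, (c.1 0 i)%:C%C \in [seq (c.1 0 i)%:C%C | i : 'I_r],
      forall j, c.2 0 j \in [seq c.2 0 j | j : 'I_s]
    & forall j, conjc (c.2 0 j) \in [seq conjc (c.2 0 j) | j : 'I_s]].
Proof. by split=> j; apply/mapP; exists j; rewrite ?mem_enum. Qed.

Lemma conjugates_ofP (r s : nat) (c : Kspace R r s) z : conjugates_of t c ->
  (exists b k, z = conjc_if b (kc c k)) <-> galois_conj t z /\ z != t%:C%C.
Proof.
case=> _ cz; have [m1 m2 m3] := mem_conj_seq c; rewrite -cz !mem_cat.
split=> [[b [[i|j] ->]]|].
- have -> : conjc_if b (kc c (inl i)) = (c.1 0 i)%:C%C by case: b => //=; rewrite oppr0.
  by rewrite m1.
- by case: b; rewrite ?m2 ?m3 ?orbT.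
- case/or3P => /mapP[i _ ->]; first by exists false, (inl i).
    by exists false, (inr i).
  by exists true, (inr i).
Qed.

Lemma conjugates_of_galois (r s : nat) (c : Kspace R r s) k : conjugates_of t c ->
  galois_conj t (kc c k) /\ kc c k != t%:C%C.
Proof. by move=> tc; apply/(conjugates_ofP _ tc); exists false, k. Qed.

(** The absence of repetitions separates real entries, non-real entries and their conjugates. The
    second conclusion replaces [a = b], which can fail at a real index, where conjugation does
    nothing. *)
Lemma conjugates_of_inj (r s : nat) (c : Kspace R r s) a b k l :
    conjugates_of t c -> conjc_if a (kc c k) = conjc_if b (kc c l) ->
  k = l /\ forall x : Kspace R r s, conjc_if a (kc x k) = conjc_if b (kc x l).
Proof.
case=> + _; have [m1 m2 m3] := mem_conj_seq c; rewrite cat_uniq.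
move=> /and3P[/injectiveP inj1 disj].
rewrite cat_uniq => /and3P[/injectiveP inj2 disj2 _].
have real_if (x : Kspace R r s) d i : conjc_if d (kc x (inl i)) = (x.1 0 i)%:C%C.
  by case: d => //=; rewrite oppr0.
have neq12 d i j : (c.1 0 i)%:C%C = conjc_if d (c.2 0 j) -> False.
  move=> e; move/hasPn: disj => /(_ (c.1 0 i)%:C%C); rewrite /= m1 => /contraL /(_ isT).
  by rewrite mem_cat e; case: (d); rewrite ?m2 ?m3 ?orbT.
have neq2 i j : conjc (c.2 0 i) = c.2 0 j -> False.
  move=> e; move/hasPn: disj2 => /(_ _ (m3 i)) /negP; apply.
  by rewrite /= e m2.
case: k l => [i|i] [j|j]; rewrite ?real_if.
- by move=> /inj1 ->; split=> // x; rewrite !real_if.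
- by move=> /neq12.
- by move/esym => /neq12.
case: a b => [] [] /=.
- by move=> /(congr1 conjc); rewrite !conjcK => /inj2 ->.
- by move=> /neq2.
- by move/esym => /neq2.
- by move=> /inj2 ->.
Qed.

Lemma conjugates_of_coord (r s r' s' : nat) (c : Kspace R r s) (c' : Kspace R r' s') :
    conjugates_of t c -> conjugates_of t c' ->
  exists (G : Kspace R r s -> Kspace R r' s') tau b,
    kc c' =1 (fun k => conjc_if (b k) (kc c (tau k))) /\
    forall x k, kc (G x) k = conjc_if (b k) (kc x (tau k)).
Proof.
move=> tc tc'.
have : forall k, exists bl : bool * ('I_r + 'I_s), kc c' k = conjc_if bl.1 (kc c bl.2).
  move=> k; have /(conjugates_ofP _ tc)[b [l e]] := conjugates_of_galois k tc'.
  by exists (b, l).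
move=> /choice[f fE].
exists (fun x => (\row_i complex.Re (conjc_if (f (inl i)).1 (kc x (f (inl i)).2)),
                  \row_j conjc_if (f (inr j)).1 (kc x (f (inr j)).2))).
exists (fun k => (f k).2), (fun k => (f k).1); split=> // x [i|j] /=; last by rewrite mxE.
rewrite mxE.
(* A real conjugate equals its own complex conjugate. By [conjugates_of_inj] the coordinate of any
   [x] that feeds this place is then real too, so taking [Re] loses nothing. *)
have : conjc_if true (kc c' (inl i)) = kc c' (inl i) by rewrite /= oppr0.
rewrite !fE conjc_ifK => /(conjugates_of_inj tc)[_ /(_ x)].
rewrite -conjc_ifK; case: (conjc_if (f _).1 _) => u v /= [/eqP].
by rewrite eq_sym -addr_eq0 -mulr2n mulrn_eq0 /= => /eqP ->.
Qed.

(** The changes of enumeration in the two directions are mutually inverse. This covers pairs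
    [(r, s)] and [(r', s')] not known beforehand to agree. *)
Lemma conjugates_of_kiso (r s r' s' : nat) (c : Kspace R r s) (c' : Kspace R r' s') :
    conjugates_of t c -> conjugates_of t c' ->
  exists G : Kspace R r s -> Kspace R r' s', exists tau b,
    [/\ kiso G, kc c' =1 (fun k => conjc_if (b k) (kc c (tau k)))
      & forall x k, kc (G x) k = conjc_if (b k) (kc x (tau k))].
Proof.
move=> tc tc'.
have [G [tau [b [cE GE]]]] := conjugates_of_coord tc tc'.
have [H [tau' [b' [c'E HE]]]] := conjugates_of_coord tc' tc.
exists G, tau, b; split=> //.
have lip r1 s1 r2 s2 (K : Kspace R r1 s1 -> Kspace R r2 s2) sg d :
    (forall x k, kc (K x) k = conjc_if (d k) (kc x (sg k))) -> klipschitz K.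
  move=> KE; exists (#|{: 'I_r2 + 'I_s2}|%:R + 1); first by rewrite ltr_wpDl.
  move=> x y; apply: (@le_trans _ _ (\sum_(k : 'I_r2 + 'I_s2) knorm (ksub x y))).
    apply: ler_sum => k _.
    have -> : kc (ksub (K x) (K y)) k = conjc_if (d k) (kc (ksub x y) (sg k)).
      by rewrite !kc_sub !KE; case: (d k) => //=; rewrite rmorphB.
    by rewrite normc_conjc_if kc_le_knorm.
  by rewrite sumr_const mulrDl mul1r mulr_natl lerDl knorm_ge0.
exists H; split.
- exact: lip GE.
- exact: lip HE.
(* The composite fixes the point [c] of distinct conjugates, hence by [conjugates_of_inj] it fixes
   every [x]. *)
- move=> x; apply: kcP => k; rewrite HE GE conjc_ifK.
  have := c'E k; rewrite cE conjc_ifK.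
  by move=> /(@conjugates_of_inj _ _ _ false _ _ _ tc) [_ /(_ x)] <-.
- move=> x; apply: kcP => k; rewrite GE HE conjc_ifK.
  have := cE k; rewrite c'E conjc_ifK.
  by move=> /(@conjugates_of_inj _ _ _ false _ _ _ tc') [_ /(_ x)] <-.
Qed.

End ConjugateCoordinates.
(** * Tent-tiles as Rauzy fractals *)

Section SpecialPisotRelations.
Variables (R : realType) (n : nat) (alpha : R).
Hypotheses (alpha_gt1 : 1 < alpha).

Lemma special_relation : alpha ^+ n.+3 = beta alpha ^+ 2 ->
  alpha ^+ n.+1 * (alpha - 1) ^+ 2 = 1.
Proof.
move=> rel; have a0 : alpha != 0 by rewrite gt_eqF // (lt_trans _ alpha_gt1).
have b0 : alpha - 1 != 0 by rewrite subr_eq0 gt_eqF.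
apply: (mulfI (expf_neq0 2 a0)); rewrite mulr1 mulrA -exprD rel /beta.
by field.
Qed.

Hypothesis alphaE : alpha ^+ n.+1 * (alpha - 1) ^+ 2 = 1.

(** Multiplying by [alphaE] clears the denominator, which exhibits [beta] as an element of
    [Qadj alpha]. *)
Lemma beta_poly : beta alpha = alpha ^+ n.+2 * (alpha - 1).
Proof.
have b0 : alpha - 1 != 0 by rewrite subr_eq0 gt_eqF.
rewrite /beta -[LHS]mulr1 -[X in _ * X]alphaE [alpha ^+ n.+2]exprS; field.
exact: b0.
Qed.

(** This is [1/alpha + 1/beta = 1] without inverses, a form that passes directly to conjugates. *)
Lemma beta_mul_alpha : beta alpha * alpha = beta alpha + alpha.
Proof.
have b0 : alpha - 1 != 0 by rewrite subr_eq0 gt_eqF.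
by rewrite /beta; field; exact: b0.
Qed.

(** Two distinct dominant roots would each exceed the other. *)
Lemma dominant_root_unique (lam : R) :
  dominant_root (@zeta n.+3) lam -> lam = alpha.
Proof.
move=> [lam0 lamE lam_dom]; have [_ _ a_dom] := dominant_root_zeta alpha_gt1 alphaE.
have eigC (x : R) : x ^+ n.+1 * (x - 1) ^+ 2 == 1 ->
    eigenvalue (map_mx intr (incidence_mx (@zeta n.+3)) : 'M[R[i]]_n.+3) x%:C%C.
  move=> /eqP xE; rewrite eigenvalue_zeta -(rmorph1 (@real_complex R)).
  by rewrite -rmorphB -!rmorphXn -rmorphM xE.
move: lamE; rewrite eigenvalue_zeta => lamE.
have a0 : 0 < alpha by apply: lt_trans alpha_gt1.
apply/eqP/negPn/negP => neq.
have := a_dom _ (eigC _ lamE); have := lam_dom _ (eigC _ (introT eqP alphaE)).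
rewrite !norm_normc !ltcR /= !expr0n !addr0 !sqrtr_sqr !gtr0_norm //.
rewrite !eq_complex /= !eqxx !andbT neq eq_sym neq => /(_ isT) lt1 /(_ isT) lt2.
by have := lt_trans lt1 lt2; rewrite ltxx.
Qed.

End SpecialPisotRelations.

(** * The Rauzy equations for the rescaled subtiles of the tent-tile *)

Section RauzyOfTent.
Variables (R : realType) (n : nat) (alpha : R).
Let p := n.+3.
Hypotheses (alpha_gt1 : 1 < alpha)
  (alphaE : alpha ^+ n.+1 * (alpha - 1) ^+ 2 = 1)
  (rel : alpha ^+ p = beta alpha ^+ 2).
Variables (r s r' s' : nat) (c : Kspace R r s) (c' : Kspace R r' s').
Hypothesis conj_c' : conjugates_of alpha c'.
Variables (tau : 'I_r' + 'I_s' -> 'I_r + 'I_s) (b : 'I_r' + 'I_s' -> bool).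
Hypothesis c'E : kc c' =1 (fun k => conjc_if (b k) (kc c (tau k))).
Variable nu : 'rV[R]_p.
Hypothesis nuP : positive_left_eigenvector (@zeta p) alpha nu.

(* [tent_scale] is [- nu_1 / alpha], written as a polynomial in [alpha]: the
   branch [f_R o f_L] has translation part [beta - alpha beta = - alpha], and
   the corresponding Rauzy branch has translation part [nu_1]. *)
Definition tent_scale : R := - (nu 0 (inord 1) * (alpha ^+ n * (alpha - 1) ^+ 2)).

Lemma tent_scale_alpha : alpha * tent_scale = - nu 0 (inord 1).
Proof.
rewrite /tent_scale mulrN mulrCA mulrA; congr (- _).
by rewrite -mulrA [alpha * _]mulrA -exprS alphaE mulr1.
Qed.

Lemma Qadj_tent_scale : Qadj alpha tent_scale.
Proof.
have [_ /(_ (inord 1)) [_ Qnu]] := nuP.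
apply/QadjN/QadjM => //; apply: QadjM; apply: QadjX; first exact: Qadj_id.
by apply: QadjD (Qadj_id _) _; apply/QadjN/Qadj1.
Qed.

Lemma tent_scale_neq0 : tent_scale != 0.
Proof.
have [_ /(_ (inord 1)) [nu0 _]] := nuP.
apply/eqP => t0; have := tent_scale_alpha; rewrite t0 mulr0 => /eqP.
by rewrite eq_sym oppr_eq0 gt_eqF.
Qed.

Lemma Qadj_beta : Qadj alpha (beta alpha).
Proof.
rewrite (beta_poly alpha_gt1 alphaE); apply: QadjM; first exact/QadjX/Qadj_id.
by apply: QadjD (Qadj_id _) _; apply/QadjN/Qadj1.
Qed.

(** Each relation is the image under the embedding [E] of an identity in [Qadj alpha]. They are the
    only arithmetic needed in one coordinate. *)
Lemma conjugate_relations k :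
  let y := kc c' k in let E := conj_image alpha y in
  [/\ y != 0, E (beta alpha) * y = E (beta alpha) + y,
      E (beta alpha) ^+ 2 = y ^+ p,
      E (nu 0 (inord 1)) = - (y * E tent_scale)
    & E (nu 0 (inord n.+2)) = - (y ^+ n.+2 * E tent_scale)].
Proof.
move=> y E; have [gy _] : galois_conj alpha y /\ _ := conjugates_of_galois k conj_c'.
have Ea : E alpha = y by apply: conj_image_id.
have Qa := Qadj_id alpha; have Qb := Qadj_beta; have Qt := Qadj_tent_scale.
have EX u m : Qadj alpha u -> E (u ^+ m) = E u ^+ m.
  move=> Qu; elim: m => [|m IH]; first exact: conj_image1.
  by rewrite !exprS /E conj_imageM //; [congr (_ * _)|exact: QadjX].
have [nuM Qnu] := nuP.
have [nuk _ _] := eigenvector_zeta nuM.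
have Enu1 : E (nu 0 (inord 1)) = - (y * E tent_scale).
  rewrite -[nu 0 _]opprK -tent_scale_alpha /E conj_imageN ?conj_imageM ?conj_image_id //.
  exact: QadjM.
split=> //.
- by rewrite -Ea conj_image_eq0 // gt_eqF // (lt_trans _ alpha_gt1).
- by rewrite -[in LHS]Ea -[X in _ + X]Ea -conj_imageM // -conj_imageD // beta_mul_alpha.
- by rewrite -EX // -rel EX // Ea.
- rewrite nuk // /E conj_imageM; last exact: (Qnu _).2.
  + by rewrite -/(E _) EX // Ea -/(E _) Enu1 mulrN mulrA -exprSr.
  + by [].
  + exact: QadjX.
Qed.

Variable Phi : Kspace R r s -> Kspace R r' s'.
Hypothesis PhiE : forall x k, kc (Phi x) k =
  conj_image alpha (kc c' k) tent_scale * conjc_if (b k) (kc x (tau k)).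

Local Notation g U := (g_map alpha c' nu U).
Local Notation fL := (fL alpha c).
Local Notation fR := (fR alpha c).

Lemma kc_g U x k :
  kc (g U x) k = conj_image alpha (kc c' k) (\sum_(a <- U) nu 0 a) + kc c' k * kc x k.
Proof. by rewrite kc_add kc_embed kc_mul mul_ell. Qed.

Lemma conjc_if_embed k u :
  conjc_if (b k) (kc (embed alpha c u) (tau k)) = conj_image alpha (kc c' k) u.
Proof. by rewrite kc_embed c'E conj_image_conjc_if. Qed.

Lemma conjc_ifM d x y : conjc_if d (x * y) = conjc_if d x * conjc_if d y :> R[i].
Proof. by case: d => //=; rewrite rmorphM. Qed.

Lemma conjc_ifB d x y : conjc_if d (x - y) = conjc_if d x - conjc_if d y :> R[i].
Proof. by case: d => //=; rewrite rmorphB. Qed.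

Lemma conjc_if_fL x k :
  conjc_if (b k) (kc (fL x) (tau k)) = kc c' k * conjc_if (b k) (kc x (tau k)).
Proof.
have [gy _] := conjugates_of_galois k conj_c'.
by rewrite kc_mul conjc_ifM conjc_if_embed conj_image_id.
Qed.

Lemma conjc_if_fR x k :
  conjc_if (b k) (kc (fR x) (tau k)) =
  conj_image alpha (kc c' k) (beta alpha) * (1 - conjc_if (b k) (kc x (tau k))).
Proof.
have [gy _] := conjugates_of_galois k conj_c'.
by rewrite kc_mul conjc_ifM kc_sub conjc_ifB !conjc_if_embed conj_image1.
Qed.

Lemma conjc_if_iter_fL m x k :
  conjc_if (b k) (kc (iter m fL x) (tau k)) =
  kc c' k ^+ m * conjc_if (b k) (kc x (tau k)).
Proof.
by elim: m => [|m IH]; rewrite ?mul1r // iterS conjc_if_fL IH exprS mulrA.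
Qed.

Lemma g_nil x : g [::] (Phi x) = Phi (fL x).
Proof.
apply: kcP => k; have [gy _] := conjugates_of_galois k conj_c'.
by rewrite kc_g big_nil conj_image0 // add0r !PhiE conjc_if_fL mulrCA.
Qed.

(** Both sides are affine with the same linear part; the translation parts agree by
    [B y = B + y]. *)
Lemma g_one x : g [:: inord 1] (Phi (fR x)) = Phi (fR (fL x)).
Proof.
apply: kcP => k; have [_ By _ E1 _] := conjugate_relations k.
rewrite kc_g big_seq1 !PhiE !conjc_if_fR conjc_if_fL E1.
set y := kc c' k in By *; set B := conj_image _ _ (beta alpha) in By *.
set W := conj_image _ _ tent_scale; set X := conjc_if _ _.
apply/eqP; rewrite -subr_eq0; apply/eqP.
have -> : - (y * W) + y * (W * (B * (1 - X))) - W * (B * (1 - y * X)) =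
  W * (B * y - (B + y)) by ring.
by rewrite By subrr mulr0.
Qed.

(** Here the linear parts agree by [B^2 = y^p], the conjugate form of [rel], and the translation
    parts by [BB]. *)
Lemma g_last x : g [:: inord n.+2] (Phi (iter n.+2 fL x)) = Phi (fR (fR x)).
Proof.
apply: kcP => k; have [y0 By B2 _ En] := conjugate_relations k.
rewrite kc_g big_seq1 !PhiE !conjc_if_fR conjc_if_iter_fL En.
set y := kc c' k in y0 By B2 *; set B := conj_image _ _ (beta alpha) in By B2 *.
set W := conj_image _ _ tent_scale; set X := conjc_if _ _.
(* Using [B y = B + y] twice turns [(B - B^2) y] into [- B^2], which is [- y^p]. *)
have BB : B - B ^+ 2 = - y ^+ n.+2.
  apply: (mulIf y0); rewrite mulNr -exprSr -B2.
  have -> : (B - B ^+ 2) * y = B * y - B * (B * y) by ring.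
  by rewrite By mulrDr By; ring.
have -> : W * (B * (1 - B * (1 - X))) = W * (B - B ^+ 2) + W * B ^+ 2 * X by ring.
by rewrite BB B2 /p [y ^+ n.+3]exprS; ring.
Qed.

Variable F : set (Kspace R r s).
Hypothesis FE : F = (fL @` F) `|` (fR @` F).

(** The edges match the pieces of the subtiles: [F] is split by [FE] exactly at the letters 0 and
    [p-1], the two letters with two incoming edges. *)
Lemma rauzy_of_tent (a : 'I_p) :
  Phi @` tent_subtile alpha c p F a = [set x | exists d U V,
    zeta d = U ++ a :: V /\ (g U @` (Phi @` tent_subtile alpha c p F d)) x].
Proof.
have FL u : F u -> F (fL u) by move=> Fu; rewrite FE; left; exists u.
have FR u : F u -> F (fR u) by move=> Fu; rewrite FE; right; exists u.
have Xlast (d : 'I_p) : val d = n.+2 -> tent_subtile alpha c p F d = iter n.+2 fL @` F.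
  by rewrite /tent_subtile => ->; rewrite eqxx.
have Xlt (d : 'I_p) : (d < n.+2)%N -> tent_subtile alpha c p F d = (iter d fL \o fR) @` F.
  by move=> dn; rewrite /tent_subtile ifF // ltn_eqF.
have val1 : val (inord 1 : 'I_p) = 1%N by rewrite /= inordK.
have valn : val (inord n.+2 : 'I_p) = n.+2 by rewrite /= inordK.
apply/seteqP; split=> [_ [z Xz <-]|x [d [U [V [zd [_ [z Xz <-] <-]]]]]] /=; last first.
  have [[-> [ad|[an dn]]]|[u [-> a0 du]]] := zeta_split zd.
  - rewrite g_nil; exists (fL z) => //.
    have dn : (d < n.+2)%N by have := ltn_ord a; rewrite [nat_of_ord a]ad ltnS.
    move: Xz; rewrite Xlt // => -[v Fv <-].
    have [an|an] := eqVneq (val a) n.+2.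
      (* The edge from [p-2] to [p-1] yields [f_L^(p-1) f_R F], which lies in [f_L^(p-1) F] because
         [f_R F] lies in [F]. *)
      rewrite Xlast //; exists (fR v); first exact: FR.
      by move: ad; rewrite an => -[->].
    rewrite Xlt; last by rewrite ltn_neqAle an -ltnS ltn_ord.
    by exists v => //; rewrite [nat_of_ord a]ad.
  - rewrite g_nil; exists (fL z) => //.
    move: Xz; rewrite !Xlast // => -[v Fv <-].
    by exists (fL v); [exact: FL|rewrite -iterSr].
  - rewrite Xlt ?[nat_of_ord a]a0 //.
    case: du => -[dE uE].
      move: Xz; rewrite Xlt ?[nat_of_ord d]dE // => -[v Fv <-].
      have -> : u = inord 1 by apply: val_inj; rewrite val1.
      by rewrite g_one; exists (fR (fL v)) => //; exists (fL v) => //; apply: FL.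
    move: Xz; rewrite Xlast // => -[v Fv <-].
    have -> : u = inord n.+2 by apply: val_inj; rewrite valn.
    by rewrite g_last; exists (fR (fR v)) => //; exists (fR v) => //; apply: FR.
have [a0|a0] := eqVneq (val a) 0%N.
  move: Xz; rewrite Xlt ?[nat_of_ord a]a0 //= => -[u + <-].
  (* Points of [f_R f_L F] come from the letter 0 with prefix 1, points of [f_R f_R F] from [p-1]
     with prefix [p-1]. *)
  rewrite {1}FE => -[] [v Fv <-].
    exists a, [:: inord 1], [::]; split; first exact: zeta0.
    rewrite -g_one; exists (Phi (fR v)) => //; exists (fR v) => //.
    by rewrite Xlt ?[nat_of_ord a]a0 //; exists v.
  exists (inord n.+2), [:: inord n.+2], [::]; split; first exact: zeta_last.
  rewrite -g_last; exists (Phi (iter n.+2 fL v)) => //; exists (iter n.+2 fL v) => //.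
  by rewrite Xlast //; exists v.
have ltpred : (a.-1 < n.+2)%N.
  by have := ltn_ord a; rewrite /p in a0 *; case: (nat_of_ord a) a0.
have valp : val (inord a.-1 : 'I_p) = a.-1 by rewrite /= inordK // ltnW.
(* The edge from the preceding letter, shared by the last letter and the intermediate ones. *)
have pred u : F u -> z = fL (iter a.-1 fL (fR u)) ->
    exists d U V, zeta d = U ++ a :: V /\
      (g U @` (Phi @` tent_subtile alpha c p F d)) (Phi z).
  move=> Fu ->; have [|V zV] := @zeta_succ n a (inord a.-1).
    by rewrite [nat_of_ord (inord _)]valp prednK // lt0n.
  exists (inord a.-1), [::], V; split=> //.
  rewrite -g_nil; exists (Phi (iter a.-1 fL (fR u))) => //.
  exists (iter a.-1 fL (fR u)) => //.
  by rewrite Xlt ?[nat_of_ord (inord _)]valp //; exists u.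
have [an|an] := eqVneq (val a) n.+2.
  move: Xz; rewrite Xlast // => -[u + zE].
  (* Points of [f_L^(p-1) f_R F] come from [p-2], those of [f_L^(p-1) f_L F] from [p-1] itself. *)
  rewrite {1}FE => -[] [v Fv vu]; last first.
    by apply: (pred v) => //; rewrite -zE -vu -iterS [nat_of_ord a]an.
  exists a, [::], [:: inord 0]; split; first by apply: zeta_last => //=; rewrite inordK.
  rewrite -zE -vu -iterSr iterS -g_nil; exists (Phi (iter n.+2 fL v)) => //.
  by exists (iter n.+2 fL v) => //; rewrite Xlast //; exists v.
move: Xz; rewrite Xlt; last by rewrite ltn_neqAle an -ltnS ltn_ord.
by move=> [u Fu /= zE]; apply: (pred u) => //; rewrite -zE -iterS prednK // lt0n.
Qed.

End RauzyOfTent.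

(** * Identification of the Rauzy fractals by uniqueness of the attractor *)

Theorem theorem4p1 (R : realType) (alpha : R) (p : nat)
    (Halpha : special_pisot_unit alpha) (Hp : (3 <= p)%N)
    (Hrel : alpha ^+ p = beta alpha ^+ 2) :
  [/\ primitive (@zeta p), unimodular (@zeta p),
      pisot_substitution R (@zeta p) & dominant_root (@zeta p) alpha] /\
  forall (r s : nat) (c : Kspace R r s) (F : set (Kspace R r s))
         (lam : R) (r' s' : nat) (c' : Kspace R r' s') (nu : 'rV[R]_p)
         (Rz : 'I_p -> set (Kspace R r' s')),
    conjugates_of alpha c ->
    is_tent_tile alpha c F ->
    dominant_root (@zeta p) lam ->
    conjugates_of lam c' ->
    positive_left_eigenvector (@zeta p) lam nu ->
    is_rauzy_family (@zeta p) lam c' nu Rz ->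
    exists Phi : Kspace R r s -> Kspace R r' s',
      [/\ klinear Phi, bijective Phi
        & forall k : 'I_p, Rz k = Phi @` tent_subtile alpha c p F k].
Proof.
case: p Hp Hrel => [//|[//|[//|n]]] _ rel.
have [[a1 _ a_lt1] _ _] := Halpha.
have aE := special_relation a1 rel.
have a_dom := dominant_root_zeta a1 aE.
split.
  split=> //; first exact: zeta_primitive; first exact: zeta_unimodular.
  by exists alpha => //; have [] := Halpha.
move=> r s c F lam r' s' c' nu Rz conj_c [F0 cF FE] /(dominant_root_unique a1 aE) ->.
move=> conj_c' nuP RzP.
have [G [tau [b [isoG c'E GE]]]] := conjugates_of_kiso conj_c conj_c'.
pose t := tent_scale alpha nu.
(* First match the two enumerations of conjugates, then rescale by the conjugates of [t]. *)
pose Phi x := kmul (embed alpha c' t) (G x).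
have PhiE x k :
    kc (Phi x) k = conj_image alpha (kc c' k) t * conjc_if (b k) (kc x (tau k)).
  by rewrite kc_mul kc_embed GE.
have embed_neq0 (r1 s1 : nat) (c1 : Kspace R r1 s1) u : conjugates_of alpha c1 ->
    Qadj alpha u -> u != 0 -> forall k, kc (embed alpha c1 u) k != 0.
  move=> conj_c1 Qu u0 k; have [gk _] := conjugates_of_galois k conj_c1.
  by rewrite kc_embed conj_image_eq0.
have a0 : alpha != 0 by rewrite gt_eqF // (lt_trans _ a1).
have isoPhi : kiso Phi.
  apply: (kiso_comp (kiso_mul _) isoG); apply: embed_neq0 => //.
    exact: Qadj_tent_scale nuP.
  exact: (tent_scale_neq0 aE nuP).
have isoL : kiso (fL alpha c).
  by apply/kiso_mul/embed_neq0 => //; apply: Qadj_id.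
have isoR : kiso (fR alpha c).
  apply: (kiso_comp (kiso_mul _) (kiso_reflect _)); apply: embed_neq0 => //.
    exact: Qadj_beta a1 aE.
  by rewrite mulf_neq0 // invr_eq0 subr_eq0 gt_eqF.
exists Phi; split.
- move=> a x y; apply: kcP => k.
  rewrite kc_add kc_scale !PhiE kc_add kc_scale.
  have -> : conjc_if (b k) (a%:C%C * kc x (tau k) + kc y (tau k)) =
      a%:C%C * conjc_if (b k) (kc x (tau k)) + conjc_if (b k) (kc y (tau k)).
    by case: (b k); rewrite /conjc_if // rmorphD rmorphM /= oppr0.
  by ring.
- by have [H [_ _ PhiK HK]] := isoPhi; exists H.
pose X := tent_subtile alpha c n.+3 F.
(* Each rescaled subtile is a bi-Lipschitz image of [F], from which it inherits non-emptiness,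
   boundedness and closedness. *)
have isoX k : exists2 K : Kspace R r s -> Kspace R r' s', kiso K & Phi @` X k = K @` F.
  rewrite /X /tent_subtile; case: ifP => _.
    exists (Phi \o iter n.+2 (fL alpha c)); last by rewrite image_comp.
    exact: kiso_comp isoPhi (kiso_iter _ isoL).
  exists (Phi \o (iter k (fL alpha c) \o fR alpha c)); last by rewrite image_comp.
  exact: kiso_comp isoPhi (kiso_comp (kiso_iter _ isoL) isoR).
have XP (a : 'I_n.+3) :
  [/\ (Phi @` X a) !=set0, kbounded (Phi @` X a) & kclosed (Phi @` X a)].
  have [K isoK ->] := isoX a; split.
  - by case: F0 => x Fx; exists (K x), x.
  - by apply: kiso_kbounded => //; apply: compact_kbounded.
  - by apply: kiso_kclosed => //; apply: compact_kclosed.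
have RP a : [/\ Rz a !=set0, kbounded (Rz a) & kclosed (Rz a)].
  have [R0 cR _] := RzP a; split=> //.
    exact: compact_kbounded.
  exact: compact_kclosed.
pose T (a d : 'I_n.+3) := [set v | exists U V, zeta d = U ++ a :: V /\
  v = embed alpha c' ((nu *m map_mx intr (ell U)) 0 0)].
(* The Pisot property of [alpha] is what makes the system contractive. *)
have contr k : normc (kc c' k) < 1.
  have [gk nk] := conjugates_of_galois k conj_c'.
  by have := a_lt1 _ gk nk; rewrite norm_normc -(rmorph1 (@real_complex R)) ltcR.
have sub (A : 'I_n.+3 -> set (Kspace R r' s')) :
    (forall a, A a = [set x | exists d U V, zeta d = U ++ a :: V /\
       (g_map alpha c' nu U @` A d) x]) ->
    (forall a x, A a x ->
      exists d v y, [/\ T a d v, A d y & x = Defs.kadd v (kmul c' y)]) /\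
    (forall a d v y, T a d v -> A d y -> A a (Defs.kadd v (kmul c' y))).
  move=> AE; split=> [a x|a d v y [U [V [zd ->]]] Ay].
    rewrite {1}AE => -[d [U [V [zd [y Ay <-]]]]].
    exists d, (embed alpha c' ((nu *m map_mx intr (ell U)) 0 0)), y.
    by split=> //; exists U, V.
  by rewrite AE; exists d, U, V; split=> //; exists y.
have [subR supR] := sub Rz (fun a => let: And3 _ _ h := RzP a in h).
have [subX supX] := sub (fun a => Phi @` X a)
  (rauzy_of_tent a1 aE rel conj_c' c'E nuP PhiE FE).
(* Both families solve the same system, so each is contained in the other. *)
move=> k; apply/seteqP; split.
  by apply: (attractor_subset (A := Rz) contr _ XP subR supX) => a; have [] := RP a.
by apply: (attractor_subset (B := Rz) contr _ RP subX supR) => a; have [] := XP a.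
Qed.
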